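(* Let $m>n$ be positive integers, let $\mathbf{d}=(d_1,\dots,d_n)$ be integers with $0<d_1<\dots<d_n<m$, and let $\mathbf{f}=(f_1,\dots,f_{n-1})$ be a tuple of linear endomorphisms of $\mathbb{C}^m$. The linear degeneration $\mathcal{F}l^{\mathbf{f}}_{\mathbf{d}}(\mathbb{C}^m)$ is smooth if and only if for all $i\in\{1,\dots,n-1\}$ either $\mathrm{rk}\, f_i=0$ or $\mathrm{rk}\, f_i=m$.
   Context: The linear degeneration $\mathcal{F}l^{\mathbf{f}}_{\mathbf{d}}(\mathbb{C}^m)$ is the algebraic variety (closed in $\mathrm{Gr}_{d_1}(\mathbb{C}^m)\times\dots\times \mathrm{Gr}_{d_n}(\mathbb{C}^m)$) of tuples $(V_1,\dots,V_n)$ of linear subspaces of $\mathbb{C}^m$ with $\dim V_i=d_i$ for all $i$ and $f_i(V_i)\subset V_{i+1}$ for $1\le i\le n-1$. *)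

(* Defs.v *)
From mathcomp Require Import all_boot all_order all_algebra.
From mathcomp Require Import mpoly.

Set Implicit Arguments.
Unset Strict Implicit.
Unset Printing Implicit Defensive.

Import GRing.Theory.
Local Open Scope ring_scope.

Section AffineSmoothness.
Variables (K : fieldType) (N : nat).

Definition vanishes_on (Z : ('I_N -> K) -> Prop) (p : {mpoly K[N]}) : Prop :=
  forall x, Z x -> p.@[x] = 0.

Definition jacobian (c : nat) (g : 'I_c -> {mpoly K[N]}) (x : 'I_N -> K) :
    'M[K]_(c, N) :=
  \matrix_(j < c, k < N) (mderiv k (g j)).@[x].

(* Smoothness over K, at the point x, of a closed subset Z of affine N-space
   with its reduced structure: on some principal open neighbourhood h != 0 of
   x, the coordinate ring of Z is K[X]_h / (g_1, ..., g_c), where the Jacobian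
   matrix of g_1, ..., g_c has rank c at x.  The last conjunct says that the
   g_j, which lie in the ideal I(Z), generate the localization I(Z)_h.        *)
Definition smooth_at (Z : ('I_N -> K) -> Prop) (x : 'I_N -> K) : Prop :=
  exists (c : nat) (g : 'I_c -> {mpoly K[N]}) (h : {mpoly K[N]}),
    [/\ h.@[x] != 0,
        \rank (jacobian g x) = c,
        forall j, vanishes_on Z (g j)
      & forall p, vanishes_on Z p ->
          exists (e : nat) (q : 'I_c -> {mpoly K[N]}),
            h ^+ e * p = \sum_(j < c) q j * g j].

End AffineSmoothness.

Section ProductOfGrassmannians.
Variables (K : fieldType) (m n : nat).

(* The standard affine chart of Gr_{d_1}(K^m) x ... x Gr_{d_n}(K^m) attached
   to subsets S_i of {0, ..., m-1} with d_i elements consists of the (V_i)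
   such that K^m is the direct sum of V_i and of <e_b | b \notin S_i>, for all
   i.  Such a V_i has a unique basis of the form
     e_a + \sum_(b \notin S_i) x_(i, a, b) e_b      (a \in S_i),
   and the x_(i, a, b), enumerated by enum_val, are the coordinates.          *)
Definition chart_idx (S : 'I_n -> {set 'I_m}) : {set 'I_n * 'I_m * 'I_m} :=
  [set t | (t.1.2 \in S t.1.1) && (t.2 \notin S t.1.1)].

Definition chart_vec (S : 'I_n -> {set 'I_m}) (x : 'I_#|chart_idx S| -> K)
    (i : 'I_n) (a : 'I_m) : 'rV[K]_m :=
  delta_mx 0 a +
  \sum_(k < #|chart_idx S| | (enum_val k).1 == (i, a))
     x k *: delta_mx 0 (enum_val k).2.

Definition chart (S : 'I_n -> {set 'I_m}) (x : 'I_#|chart_idx S| -> K)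
    (i : 'I_n) : {vspace 'rV[K]_m} :=
  <<[seq chart_vec x i a | a in S i]>>%VS.

Definition smooth_in_Gr (d : 'I_n -> nat)
    (X : ('I_n -> {vspace 'rV[K]_m}) -> Prop) : Prop :=
  forall S : 'I_n -> {set 'I_m}, (forall i, #|S i| = d i) ->
  forall x : 'I_#|chart_idx S| -> K, X (chart x) ->
    smooth_at (fun y => X (chart y)) x.

Definition linear_degeneration (d : 'I_n -> nat)
    (f : 'I_n.-1 -> 'End('rV[K]_m)) (V : 'I_n -> {vspace 'rV[K]_m}) : Prop :=
  (forall i, \dim (V i) = d i) /\
  (forall (i : 'I_n.-1) (j k : 'I_n), j = i :> nat -> k = i.+1 :> nat ->
     (f i @: V j <= V k)%VS).

End ProductOfGrassmannians.

(* Main.v *)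
Require Import Defs.
From mathcomp Require Import all_boot all_order all_algebra.
From mathcomp Require Import reals complex.
From mathcomp Require Import mpoly zify ring.

(** Write K for the ground field, Z for the trace of the degeneration on an
affine chart; a point of Z is a tuple (V_i), each V_i being the graph over a
coordinate subspace, with f_i V_i inside V_(i+1).

If every f_i is zero or bijective, Z is built one condition at a time: start
from the whole affine space, and cut by f_i V_i <= V_(i+1) for increasing i.
A zero map imposes nothing.  A bijective f_i sends the basis of V_i to
independent vectors of V_(i+1); some minor delta of their coordinate matrix
is therefore nonzero at the given point, and by Cramer's rule the condition
becomes, where delta is nonzero, delta * x_k = q_k for certain coordinates x_k
of V_(i+1), with delta and q_k free of those coordinates and of all later ones
([smooth_avoiding_injective]).  Such equations exhibit the new set, locally, as
a graph over the old one; eliminating the x_k reduces the ideal of the new set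
to that of the old one, and the Jacobian matrix is block triangular
([smooth_avoiding_step]).  The induction starts from the fact that only the
zero polynomial vanishes on all of K^N.

Conversely, assume 0 < rk f_i < m for some i.  The criterion is
[smooth_second_order]: at a smooth point, if p lies in the ideal of Z and has
zero differential there, then its Hessian vanishes on pairs of tangent
vectors, because p is locally a combination of the equations g_j whose
coefficients must vanish at the point.  It is violated as follows.  Choose v
in V_i killed by f_i, a vector w with f_i w in V_(i+1) but not in f_i V_i, and
u outside V_(i+1) + im f_i ([obstructed_flag]).  Tilting V_i along v towards w,
or V_(i+1) along f_i w towards u, gives two lines contained in Z.  Doing both
at once is obstructed at second order: v moves to v + s w, whose image s f_i w
should lie in the tilted V_(i+1), which only contains s (f_i w + s u).  Up to sign, the
function measuring this is the class of f_i v(z) modulo V_(i+1)(z), paired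
with a linear form pi that kills V_(i+1) + im f_i and takes the value 1 at u.
In coordinates it is a sum of products of two functions that vanish at the
point, so its differential is zero, while its Hessian on the two directions is
pi(u) = 1.  The remaining V_l are chosen so that the conditions next to V_i and
V_(i+1) survive both motions: V_(i-1) is sent into a hyperplane of V_i that
misses v, and V_(i+2) contains f_(i+1) u. *)

Set Implicit Arguments.
Unset Strict Implicit.
Unset Printing Implicit Defensive.

Import Order.TTheory GRing.Theory Num.Theory.
Local Open Scope ring_scope.

(** * Polynomials and directional derivatives *)

Section PolynomialsAlongLines.
Variables (K : fieldType) (N : nat).
Implicit Types (p q : {mpoly K[N]}) (x y a b : 'I_N -> K).

Lemma mpoly_alg_ind (P : {mpoly K[N]} -> Prop) :
    (forall c, P c%:MP) -> (forall k, P 'X_k) ->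
    (forall p q, P p -> P q -> P (p + q)) ->
    (forall p q, P p -> P q -> P (p * q)) ->
  forall p, P p.
Proof.
move=> PC PX PD PM p; rewrite [p]mpolyE.
have P0 : P 0 by rewrite -mpolyC0; apply: PC.
apply: (big_ind P) => // m _; rewrite -mul_mpolyC mpolyXE_id.
apply: (PM) => //; apply: (big_ind P) => [||k _]; [by rewrite -mpolyC1 | exact: PM |].
by elim: (m k) => [|e IHe]; rewrite ?expr0 -?mpolyC1 // exprS; apply: (PM).
Qed.

Lemma mderivXU (k l : 'I_N) : mderiv k 'X_l = (l == k)%:R :> {mpoly K[N]}.
Proof.
rewrite mderivX mnmE; have [->|_] := eqVneq l k; last by rewrite scale0r.
by rewrite -{1}[U_(k)%MM]add0m addmK mpolyX0 scale1r.
Qed.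

Definition dderiv a p : {mpoly K[N]} := \sum_k a k *: mderiv k p.

Lemma dderivD a p q : dderiv a (p + q) = dderiv a p + dderiv a q.
Proof.
by rewrite -big_split; apply: eq_bigr => k _; rewrite mderivD scalerDr.
Qed.

Lemma dderiv_sum a (I : Type) (r : seq I) (P : pred I) (F : I -> {mpoly K[N]}) :
  dderiv a (\sum_(i <- r | P i) F i) = \sum_(i <- r | P i) dderiv a (F i).
Proof.
rewrite [RHS]exchange_big /=; apply: eq_bigr => k _.
by rewrite (raddf_sum (mderiv k)) scaler_sumr.
Qed.

Lemma dderivM a p q : dderiv a (p * q) = dderiv a p * q + p * dderiv a q.
Proof.
rewrite /dderiv mulr_suml mulr_sumr -big_split; apply: eq_bigr => k _.
by rewrite mderivM scalerDr scalerAl scalerAr.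
Qed.

Lemma dderivC a c : dderiv a c%:MP = 0.
Proof. by apply: big1 => k _; rewrite mderivC scaler0. Qed.

Lemma dderivX a k : dderiv a 'X_k = (a k)%:MP.
Proof.
rewrite /dderiv (bigD1 k) //= mderivXU eqxx big1 ?addr0 => [|l lk].
  by rewrite -mul_mpolyC mulr1.
by rewrite mderivXU eq_sym (negPf lk) scaler0.
Qed.

(** The two terms where a single factor carries both derivatives vanish at x. *)
Lemma dderiv2_mul a b x p q : p.@[x] = 0 -> q.@[x] = 0 ->
  (dderiv a (dderiv b (p * q))).@[x] =
    (dderiv b p).@[x] * (dderiv a q).@[x] +
    (dderiv a p).@[x] * (dderiv b q).@[x].
Proof.
move=> p0 q0; rewrite !(dderivM, dderivD) !mevalD !mevalM p0 q0.
by rewrite mulr0 mul0r add0r addr0.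
Qed.

(** The restriction of p to the parametrized line x + 'X a, which turns directional
    derivatives into derivatives of polynomials in one variable. *)
Definition on_line x a : {mpoly K[N]} -> {poly K} :=
  mmap (@polyC K) (fun k => (x k)%:P + a k *: 'X).

Lemma horner_on_line x a p s :
  (on_line x a p).[s] = p.@[fun k => x k + s * a k].
Proof.
elim/mpoly_alg_ind: p => [c|k|p q IHp IHq|p q IHp IHq].
- by rewrite /on_line mmapC hornerC mevalC.
- by rewrite /on_line mmapX mmap1U !hornerE mevalXU mulrC.
- by rewrite /on_line raddfD hornerD -/(on_line _ _) IHp IHq mevalD.
- by rewrite /on_line rmorphM hornerM -/(on_line _ _) IHp IHq mevalM.
Qed.

Lemma deriv_on_line x a p : (on_line x a p)^`().[0] = (dderiv a p).@[x].
Proof.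
have eval0 q : (on_line x a q).[0] = q.@[x].
  rewrite horner_on_line; by apply: meval_eq => k; rewrite mul0r addr0.
elim/mpoly_alg_ind: p => [c|k|p q IHp IHq|p q IHp IHq].
- by rewrite /on_line mmapC derivC horner0 dderivC meval0.
- by rewrite /on_line mmapX mmap1U !derivE !hornerE dderivX mevalC.
- by rewrite /on_line raddfD derivD hornerD IHp IHq dderivD mevalD.
- rewrite /on_line rmorphM derivM hornerD !hornerM -/(on_line x a).
  by rewrite IHp IHq !eval0 dderivM mevalD !mevalM.
Qed.
End PolynomialsAlongLines.

Section InfiniteField.
Variable K : numFieldType.

Lemma poly_eq0_eval (P : {poly K}) : (forall s, P.[s] = 0) -> P = 0.
Proof.
move=> P0; apply: (@roots_geq_poly_eq0 _ P [seq i%:R | i <- iota 0 (size P)]).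
- by apply/allP=> s _; apply/rootP.
- by rewrite map_inj_uniq ?iota_uniq // => i j /eqP; rewrite eqr_nat => /eqP.
- by rewrite size_map size_iota.
Qed.

(** A line inside Z gives a vector of the Zariski tangent space of Z with its
    reduced structure, the space cut out by all of I(Z) and not only by the
    equations used to define Z. *)
Lemma dderiv_line N (Z : ('I_N -> K) -> Prop) (x a : 'I_N -> K) (p : {mpoly K[N]}) :
    (forall s, Z (fun k => x k + s * a k)) -> vanishes_on Z p ->
  (dderiv a p).@[x] = 0.
Proof.
move=> Zl Zp; rewrite -deriv_on_line (@poly_eq0_eval (on_line x a p)) ?derivC ?horner0 //.
by move=> s; rewrite horner_on_line Zp.
Qed.

(** Reads off a derivative from values, without expanding p: on the lines used
    below the polynomials are affine in the parameter. *)
Lemma dderiv_affine N (x a : 'I_N -> K) (p : {mpoly K[N]}) p0 p1 :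
  (forall s, p.@[fun k => x k + s * a k] = p0 + s * p1) -> (dderiv a p).@[x] = p1.
Proof.
move=> aff; rewrite -deriv_on_line; have -> : on_line x a p = p0%:P + p1 *: 'X.
  apply/eqP; rewrite -subr_eq0; apply/eqP/poly_eq0_eval => s.
  by rewrite hornerD hornerN horner_on_line aff !hornerE [p1 * s]mulrC subrr.
by rewrite !derivE !hornerE.
Qed.

Lemma meval_origin N (p : {mpoly K[N]}) : p.@[fun=> 0] = p@_0%MM.
Proof.
elim/mpoly_alg_ind: p => [c|k|p q IHp IHq|p q IHp IHq].
- by rewrite mevalC mcoeffC eqxx mulr1.
- by rewrite mevalXU mcoeffX mnm1_eq0.
- by rewrite mevalD mcoeffD IHp IHq.
- by rewrite mevalM (rmorphM (mcoeff 0%MM)) /= IHp IHq.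
Qed.

(** Derivatives of a polynomial vanishing everywhere vanish everywhere as well.
    In characteristic 0 the coefficient of a monomial is, up to a nonzero integer,
    a coefficient of lower degree of a derivative; descending to degree 0 leaves
    the value at the origin. *)
Lemma mpoly_eq0_eval N (p : {mpoly K[N]}) : (forall x, p.@[x] = 0) -> p = 0.
Proof.
move=> p0; apply/mpolyP=> m; rewrite mcoeff0.
have [e] := ubnP (mdeg m); elim: e m p p0 => // e IHe m p p0 me.
have [m0|/forallPn[i mi]] := boolP [forall i, m i == 0%N].
  have -> : m = 0%MM by apply/mnmP=> i; rewrite mnm0E; apply/eqP/(forallP m0).
  by rewrite -meval_origin p0.
have Um : (U_(i) <= m)%MM.
  by apply/mnm_lepP=> j; rewrite mnm1E; case: eqP => // <-; rewrite lt0n.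
have dp0 x : (mderiv i p).@[x] = 0.
  rewrite -(dderiv_line (Z := fun=> True) (x := x) (p := p)
             (a := fun l => (l == i)%:R)) // /dderiv (bigD1 i) //= eqxx scale1r.
  by rewrite big1 ?addr0 // => j /negPf->; rewrite scale0r.
have := IHe (m - U_(i))%MM _ dp0; rewrite mcoeff_mderiv submK // => c0.
have/eqP : p@_m *+ ((m - U_(i))%MM i).+1 = 0.
  by apply: c0; move: me; rewrite -{1}(submK Um) mdegD mdeg1 addn1.
by rewrite mulrn_eq0 => /eqP.
Qed.
End InfiniteField.

(** * A second-order criterion for singularity *)

Section SecondOrder.
Variables (K : fieldType) (N : nat) (Z : ('I_N -> K) -> Prop).

(** On a neighbourhood of x, p is a combination of the g_j with coefficients q_j.
    Since the differentials of the g_j at x are independent and that of p is zero,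
    all q_j vanish at x.  Each q_j g_j is then a product of two functions vanishing
    at x, and its Hessian only involves derivatives of g_j in tangent directions,
    which are zero. *)
Lemma smooth_second_order (x a b : 'I_N -> K) (p : {mpoly K[N]}) :
    smooth_at Z x -> Z x ->
    (forall q, vanishes_on Z q -> (dderiv a q).@[x] = 0) ->
    (forall q, vanishes_on Z q -> (dderiv b q).@[x] = 0) ->
    vanishes_on Z p -> (forall k, (mderiv k p).@[x] = 0) ->
  (dderiv a (dderiv b p)).@[x] = 0.
Proof.
case=> c [g [h [hx rkJ Zg gen]]] Zx ta tb Zp dp0.
have [e [q eqp]] := gen p Zp.
have q0 j : (q j).@[x] = 0.
  have /row_freeP[B JB] : row_free (jacobian g x) by rewrite /row_free rkJ.
  have uJ : (\row_j (q j).@[x]) *m jacobian g x = 0.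
    apply/rowP=> k; rewrite !mxE.
    have := congr1 (fun r => (mderiv k r).@[x]) eqp.
    rewrite mderivM mevalD !mevalM Zp // dp0 !mulr0 addr0 => /esym.
    rewrite (raddf_sum (mderiv k)) (raddf_sum (meval x)) /= => s0.
    rewrite -[RHS]s0; apply: eq_bigr => i _.
    by rewrite !mxE mderivM mevalD !mevalM Zg // mulr0 add0r.
  have /rowP/(_ j) : (\row_j (q j).@[x]) = 0.
    by rewrite -[LHS]mulmx1 -JB mulmxA uJ mul0mx.
  by rewrite !mxE.
have: (dderiv a (dderiv b (h ^+ e * p))).@[x] = 0.
  rewrite eqp (dderiv_sum b) [dderiv a _]dderiv_sum (raddf_sum (meval x)).
  apply: big1 => j _.
  by rewrite /= dderiv2_mul ?q0 ?Zg // (ta (g j)) // (tb (g j)) // !mulr0 addr0.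
rewrite !(dderivM, dderivD) !mevalD !mevalM Zp // (ta p) // (tb p) //.
rewrite !mulr0 !add0r.
by move/eqP; rewrite mulf_eq0 rmorphXn expf_eq0 (negPf hx) andbF /= => /eqP.
Qed.
End SecondOrder.

(** * Adjoining solvable equations *)

Section Elimination.
Variables (K : fieldType) (N : nat).
Implicit Types (p q : {mpoly K[N]}) (B D : {set 'I_N}).
Implicit Types (Z : ('I_N -> K) -> Prop) (x y : 'I_N -> K).

Definition in_ideal (I : finType) (g : I -> {mpoly K[N]}) p :=
  exists q : I -> {mpoly K[N]}, p = \sum_i q i * g i.

Section Ideal.
Variables (I : finType) (g : I -> {mpoly K[N]}).

Lemma in_ideal0 : in_ideal g 0.
Proof. by exists (fun=> 0); rewrite big1 // => i _; rewrite mul0r. Qed.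

Lemma in_ideal_gen i : in_ideal g (g i).
Proof.
exists (fun j => (j == i)%:R); rewrite (bigD1 i) //= eqxx mul1r big1 ?addr0 //.
by move=> j /negPf->; rewrite mul0r.
Qed.

Lemma in_idealD p q : in_ideal g p -> in_ideal g q -> in_ideal g (p + q).
Proof.
move=> [u ->] [v ->]; exists (fun i => u i + v i).
by rewrite -big_split; apply: eq_bigr => i _; rewrite mulrDl.
Qed.

Lemma in_idealM p q : in_ideal g q -> in_ideal g (p * q).
Proof.
move=> [u ->]; exists (fun i => p * u i).
by rewrite mulr_sumr; apply: eq_bigr => i _; rewrite mulrA.
Qed.

Lemma in_ideal_sub (J : finType) (g' : J -> {mpoly K[N]}) p :
  (forall j, in_ideal g (g' j)) -> in_ideal g' p -> in_ideal g p.
Proof.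
move=> gg' [u ->]; apply: (big_ind (in_ideal g)) => [||j _].
- exact: in_ideal0.
- exact: in_idealD.
- exact: in_idealM.
Qed.
End Ideal.

(** The polynomial p does not involve the coordinates in D.  Both consequences are
    recorded, the one on values and the one on derivatives, since over a general
    field neither gives the other. *)
Definition indep D p :=
  (forall x y, (forall k, k \notin D -> x k = y k) -> p.@[x] = p.@[y]) /\
  (forall k, k \in D -> mderiv k p = 0).

Lemma indepC D c : indep D c%:MP.
Proof. by split=> [x y _|k _]; rewrite ?mevalC ?mderivC. Qed.

Lemma indepX D k : k \notin D -> indep D 'X_k.
Proof.
move=> kD; split=> [x y xy|l lD]; first by rewrite !mevalXU xy.
by rewrite mderivXU (_ : k == l = false) //; apply: contraNF kD => /eqP->.
Qed.

Lemma indepD D p q : indep D p -> indep D q -> indep D (p + q).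
Proof.
move=> [p1 p2] [q1 q2]; split=> [x y xy|k kD].
  by rewrite !mevalD (p1 x y) // (q1 x y).
by rewrite mderivD p2 // q2 // addr0.
Qed.

Lemma indepM D p q : indep D p -> indep D q -> indep D (p * q).
Proof.
move=> [p1 p2] [q1 q2]; split=> [x y xy|k kD].
  by rewrite !mevalM (p1 x y) // (q1 x y).
by rewrite mderivM p2 // q2 // mul0r mulr0 addr0.
Qed.

Lemma indepN D p : indep D p -> indep D (- p).
Proof.
by move=> ?; rewrite -mulN1r -mpolyC1 -mpolyCN; apply: indepM => //; apply: indepC.
Qed.

Lemma indep_sum D (I : Type) (r : seq I) (P : pred I) (F : I -> {mpoly K[N]}) :
  (forall i, P i -> indep D (F i)) -> indep D (\sum_(i <- r | P i) F i).
Proof.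
move=> FD; apply: (big_ind (indep D)) => //; last exact: indepD.
by rewrite -mpolyC0; apply: indepC.
Qed.

Lemma indep_prod D (I : Type) (r : seq I) (P : pred I) (F : I -> {mpoly K[N]}) :
  (forall i, P i -> indep D (F i)) -> indep D (\prod_(i <- r | P i) F i).
Proof.
move=> FD; apply: (big_ind (indep D)) => //; last exact: indepM.
by rewrite -mpolyC1; apply: indepC.
Qed.

Lemma indepXn D p i : indep D p -> indep D (p ^+ i).
Proof.
move=> Dp; elim: i => [|i IHi]; first by rewrite expr0 -mpolyC1; apply: indepC.
by rewrite exprS; apply: indepM.
Qed.

Lemma indep_sign D i : indep D ((-1) ^+ i).
Proof. by apply/indepXn/indepN; rewrite -mpolyC1; apply: indepC. Qed.

Lemma indep_det D s (A : 'M[{mpoly K[N]}]_s) :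
  (forall i j, indep D (A i j)) -> indep D (\det A).
Proof.
move=> AD; apply: indep_sum => /= t _; apply: indepM; last first.
  by apply: indep_prod.
exact: indep_sign.
Qed.

Lemma indep_adj D s (A : 'M[{mpoly K[N]}]_s) i j :
  (forall i j, indep D (A i j)) -> indep D ((\adj A) i j).
Proof.
move=> AD; rewrite mxE /cofactor; apply: indepM; last first.
  by apply: indep_det => a b; rewrite !mxE.
exact: indep_sign.
Qed.

Lemma indep_subset D D' p : D' \subset D -> indep D p -> indep D' p.
Proof.
move=> /subsetP D'D [p1 p2]; split=> [x y xy|k kD']; last by apply/p2/D'D.
by apply: p1 => k kD; apply: xy; apply: contra kD; apply: D'D.
Qed.

(** Modulo the relations delta * 'X_k = q k the variables of B can be replaced by
    the fractions q k / delta; a power of delta clears the denominators. *)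
Lemma eliminate B (delta : {mpoly K[N]}) (q : 'I_N -> {mpoly K[N]}) p :
    indep B delta -> (forall k, k \in B -> indep B (q k)) ->
  exists e p', indep B p' /\
    in_ideal (fun k : 'I_#|B| => delta * 'X_(enum_val k) - q (enum_val k))
             (delta ^+ e * p - p').
Proof.
move=> Bdelta Bq; set G := fun k : 'I_#|B| => _.
elim/mpoly_alg_ind: p => [c|k|p1 p2 [e1 [p1' [B1 I1]]] [e2 [p2' [B2 I2]]]|
                          p1 p2 [e1 [p1' [B1 I1]]] [e2 [p2' [B2 I2]]]].
- exists 0%N, c%:MP; split; first exact: indepC.
  by rewrite expr0 mul1r subrr; apply: in_ideal0.
- have [kB|kB] := boolP (k \in B); last first.
    exists 0%N, 'X_k; split; first exact: indepX.
    by rewrite expr0 mul1r subrr; apply: in_ideal0.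
  exists 1%N, (q k); split; first exact: Bq.
  rewrite expr1 -(enum_rankK_in kB kB); exact: in_ideal_gen.
- exists (e1 + e2)%N, (delta ^+ e2 * p1' + delta ^+ e1 * p2'); split.
    by apply: indepD; apply: indepM => //; apply: indepXn.
  rewrite [X in in_ideal _ X](_ : _ = delta ^+ e2 * (delta ^+ e1 * p1 - p1')
            + delta ^+ e1 * (delta ^+ e2 * p2 - p2')); last first.
    rewrite exprD !mulrBr !mulrDr opprD addrACA; congr (_ - _ + (_ - _)).
      by rewrite mulrA [delta ^+ e2 * _]mulrC.
    by rewrite mulrA.
  by apply: in_idealD; apply: in_idealM.
- exists (e1 + e2)%N, (p1' * p2'); split; first exact: indepM.
  rewrite [X in in_ideal _ X](_ : _ = delta ^+ e2 * p2 * (delta ^+ e1 * p1 - p1')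
            + p1' * (delta ^+ e2 * p2 - p2')); last first.
    rewrite !mulrBr [_ * p1']mulrC addrA subrK exprD; congr (_ - _).
    by rewrite mulrACA mulrC.
  by apply: in_idealD; apply: in_idealM.
Qed.

(** Smoothness of Z at x witnessed by local equations that do not involve the
    coordinates in D.  This is what survives an induction in which the coordinates
    in D are constrained only at later stages. *)
Definition smooth_avoiding D Z x :=
  exists (c : nat) (g : 'I_c -> {mpoly K[N]}) (h : {mpoly K[N]}),
    [/\ h.@[x] != 0, \rank (jacobian g x) = c,
        forall j, vanishes_on Z (g j) /\ indep D (g j)
      & forall p, vanishes_on Z p -> exists e, in_ideal g (h ^+ e * p)].

Lemma smooth_avoiding_at D Z x : smooth_avoiding D Z x -> smooth_at Z x.
Proof.
move=> [c [g [h [hx rk Zg gen]]]]; exists c, g, h; split=> //.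
by move=> j; case: (Zg j).
Qed.

(** Where delta is nonzero, Z1 is the graph over Z0 of the functions q k / delta,
    k ranging over B, because Z0 is a cylinder in the direction of D0, which
    contains B.  Local equations of Z1 at x are those of Z0 together with
    delta * 'X_k - q k.  Only the new ones involve B, through an invertible
    diagonal block, so the Jacobian keeps full rank.  A polynomial of I(Z1)
    reduces by elimination to one not involving B; moving a point of Z0 along B
    onto Z1 shows that, after multiplication by delta, the latter is in I(Z0). *)
Lemma smooth_avoiding_step Z0 Z1 x B D0 D1 (delta : {mpoly K[N]})
    (q : 'I_N -> {mpoly K[N]}) :
    smooth_avoiding D0 Z0 x -> B :|: D1 \subset D0 -> [disjoint B & D1] ->
    indep (B :|: D1) delta -> (forall k, k \in B -> indep (B :|: D1) (q k)) ->
    (forall y z, Z0 y -> (forall k, k \notin D0 -> y k = z k) -> Z0 z) ->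
    (forall y, Z1 y -> Z0 y) ->
    (forall y, Z1 y -> forall k, k \in B -> delta.@[y] * y k = (q k).@[y]) ->
    (forall y, Z0 y -> delta.@[y] != 0 ->
       (forall k, k \in B -> delta.@[y] * y k = (q k).@[y]) -> Z1 y) ->
    delta.@[x] != 0 ->
  smooth_avoiding D1 Z1 x.
Proof.
move=> [c [g [h [hx rk Zg gen]]]] BD0 BD1 idelta iq Z0inv Z10 Z1q Z01 dx.
have [sB sD1] : B \subset D0 /\ D1 \subset D0 by apply/andP; rewrite -subUset.
have sBU := subsetUl B D1; have sDU := subsetUr B D1.
pose G (k : 'I_#|B|) := delta * 'X_(enum_val k) - q (enum_val k).
pose g' (s : 'I_(c + #|B|)) := match split s with inl j => g j | inr k => G k end.
have g'l j : g' (lshift _ j) = g j.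
  by rewrite /g'; case: split_ordP => [i /lshift_inj->|i /eqP]; rewrite ?eq_lrshift.
have g'r k : g' (rshift _ k) = G k.
  by rewrite /g'; case: split_ordP => [i /eqP|i /rshift_inj->]; rewrite ?eq_rlshift.
exists (c + #|B|)%N, g', (h * delta); split.
- by rewrite mevalM mulf_neq0.
- apply/eqP; apply: inj_row_free => u uJ.
  have dG k l : (mderiv (enum_val l) (G k)).@[x] = (k == l)%:R * delta.@[x].
    rewrite mderivB mderivM (proj2 idelta) ?(subsetP sBU) ?enum_valP // mul0r add0r.
    rewrite (proj2 (iq _ (enum_valP k))) ?(subsetP sBU) ?enum_valP // subr0.
    by rewrite mderivXU (inj_eq enum_val_inj) mevalM mulrC; case: eqP; rewrite (meval1, meval0).
  (* The column of a coordinate in B is zero on the old equations and delta(x)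
     times a unit vector on the new ones. *)
  have ur k : u 0 (rshift c k) = 0.
    have /rowP/(_ (enum_val k)) := uJ; rewrite !mxE big_split_ord /= big1 => [|j _].
      rewrite add0r (bigD1 k) //= big1 ?addr0 => [|l /negPf lk].
        by rewrite mxE g'r dG eqxx mul1r => /eqP; rewrite mulf_eq0 (negPf dx) orbF => /eqP.
      by rewrite mxE g'r dG lk mul0r mulr0.
    by rewrite mxE g'l (proj2 (Zg j).2) ?meval0 ?mulr0 // (subsetP sB) ?enum_valP.
  have ul : lsubmx u = 0.
    have /row_freeP[C JC] : row_free (jacobian g x) by apply/eqP.
    rewrite -[LHS]mulmx1 -JC mulmxA (_ : _ *m jacobian g x = 0) ?mul0mx //.
    apply/rowP=> k; have /rowP/(_ k) := uJ; rewrite !mxE big_split_ord /=.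
    rewrite [X in _ + X]big1 ?addr0 => [s0|l _]; last by rewrite ur mul0r.
    by rewrite -[RHS]s0; apply: eq_bigr => j _; rewrite !mxE g'l.
  rewrite -[u]hsubmxK ul; apply/rowP=> s; rewrite [RHS]mxE -(splitK s).
  by case: (split s) => [j|k] /=; rewrite ?row_mxEl ?row_mxEr !mxE ?ur.
- move=> s; rewrite -(splitK s); case: (split s) => [j|k] /=.
    rewrite g'l; split=> [y /Z10|]; first by apply: (Zg j).1.
    exact: indep_subset sD1 (Zg j).2.
  rewrite g'r; split=> [y Z1y|].
    by rewrite mevalB mevalM mevalXU (Z1q y) ?subrr ?enum_valP.
  apply: indepD; last by apply/indepN/(indep_subset sDU)/iq/enum_valP.
  apply: indepM; first exact: indep_subset sDU idelta.
  apply: indepX; move/pred0P: BD1 => /(_ (enum_val k)) /=.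
  by rewrite enum_valP /= => ->.
- move=> p Z1p.
  have [e [p' [Bp' Ip']]] := eliminate p (indep_subset sBU idelta)
                               (fun k kB => indep_subset sBU (iq k kB)).
  have [|e0 Ie0] := gen (delta * p').
    move=> z Z0z; rewrite mevalM.
    have [->|dz] := eqVneq delta.@[z] 0; first by rewrite mul0r.
    (* The point of Z1 lying over z. *)
    pose z' k := if k \in B then (q k).@[z] / delta.@[z] else z k.
    have zz' k : k \notin B -> z k = z' k by rewrite /z' => /negPf->.
    have Ez' r : indep B r -> r.@[z] = r.@[z'] by case=> r1 _; apply: r1.
    have iB k (kB : k \in B) := indep_subset sBU (iq k kB).
    have iBd := indep_subset sBU idelta.
    have Z1z' : Z1 z'.
      apply: Z01 => [||k kB].
      - by apply: (Z0inv z) => // k kD; apply: zz'; apply: contra kD; apply/subsetP.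
      - by rewrite -(Ez' _ iBd).
      - by rewrite -(Ez' _ iBd) -(Ez' _ (iB k kB)) /z' kB mulrC divfK.
    have [u Eu] := Ip'; have := congr1 (meval z') Eu.
    rewrite mevalB mevalM Z1p // mulr0 add0r (raddf_sum (meval z')) big1 => [|k _] /=.
      by rewrite (Ez' _ Bp') => /eqP; rewrite oppr_eq0 => /eqP->; rewrite mulr0.
    by rewrite mevalM mevalB mevalM mevalXU Z1q ?enum_valP // subrr mulr0.
  (* One factor delta goes with p', the others complete the powers of h and delta
     to a common exponent. *)
  exists (e0 + e.+1)%N.
  have -> : (h * delta) ^+ (e0 + e.+1) * p =
      h ^+ e.+1 * delta ^+ e0 * (h ^+ e0 * (delta * p'))
      + h ^+ (e0 + e.+1) * delta ^+ (e0.+1) * (delta ^+ e * p - p').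
    rewrite exprMn !exprD !exprS; ring.
  apply: in_idealD; apply: in_idealM.
    by apply: (in_ideal_sub _ Ie0) => j; rewrite -g'l; apply: in_ideal_gen.
  by apply: (in_ideal_sub _ Ip') => k; rewrite -[_ - _]g'r; apply: in_ideal_gen.
Qed.
End Elimination.

(** * Affine charts of products of Grassmannians *)

Section Charts.
Variables (K : fieldType) (m n : nat) (S : 'I_n -> {set 'I_m}).
Local Notation N := #|chart_idx S|.
Implicit Types (x y : 'I_N -> K) (i : 'I_n) (a b c : 'I_m) (v : 'rV[K]_m).

Lemma chart_vecE x i a b : chart_vec x i a 0 b =
  (a == b)%:R + \sum_(k < N | enum_val k == (i, a, b)) x k.
Proof.
rewrite !mxE eqxx /= eq_sym; congr (_ + _); rewrite summxE [RHS]big_mkcond /=.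
rewrite big_mkcond; apply: eq_bigr => k _.
case: (enum_val k) => [ia b'] /=; rewrite xpair_eqE.
have [_|_] := eqVneq ia (i, a) => //=; rewrite !mxE eqxx /= eq_sym.
by case: eqP => _; rewrite ?mulr1 ?mulr0.
Qed.

Lemma chart_vec_in x i a b : b \in S i -> chart_vec x i a 0 b = (a == b)%:R.
Proof.
move=> bS; rewrite chart_vecE big1 ?addr0 // => k /eqP Ek.
by have := enum_valP k; rewrite Ek inE /= bS andbF.
Qed.

Lemma chart_vec_out x i a b (k : 'I_N) : enum_val k = (i, a, b) ->
  chart_vec x i a 0 b = x k.
Proof.
move=> Ek; have := enum_valP k; rewrite Ek inE /= => /andP[aS bS].
rewrite chart_vecE (big_pred1 k) => [|l /=].
  by case: eqP => [ab|_]; [rewrite ab (negPf bS) in aS | rewrite add0r].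
by rewrite -Ek (inj_eq enum_val_inj).
Qed.

(** A basis vector of the chart has coordinates on S i equal to those of 'e_a, so
    the coefficients of a vector of the subspace are its coordinates on S i. *)
Lemma mem_chart x i v :
  (v \in chart x i) = (v == \sum_(a in S i) v 0 a *: chart_vec x i a).
Proof.
rewrite /chart span_def big_map big_enum /=; apply/memv_sumP/eqP => [[vs vsP ->]|->].
  apply: eq_bigr => a aS; have /vlineP[k Ek] := vsP a aS; rewrite [LHS]Ek.
  congr (_ *: _); rewrite summxE (bigD1 a) //= Ek mxE chart_vec_in // eqxx mulr1.
  rewrite big1 ?addr0 // => c /andP[cS /negPf ca].
  by have /vlineP[k' ->] := vsP c cS; rewrite mxE chart_vec_in // ca mulr0.
exists (fun a => v 0 a *: chart_vec x i a) => // a _.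
by apply/vlineP; exists (v 0 a).
Qed.

Lemma chart_vec_mem x i a : a \in S i -> chart_vec x i a \in chart x i.
Proof. by move=> aS; apply/memv_span/imageP; exists a. Qed.

Lemma chart_eq0 x i v : v \in chart x i -> (forall a, a \in S i -> v 0 a = 0) -> v = 0.
Proof.
rewrite mem_chart => vx v0; move/eqP: vx; rewrite big1 // => a aS.
by rewrite v0 // scale0r.
Qed.

Lemma chart_sum x i (u : 'I_m -> K) c : c \in S i ->
  (\sum_(a in S i) u a *: chart_vec x i a) 0 c = u c.
Proof.
move=> cS; rewrite summxE (bigD1 c) //= mxE chart_vec_in // eqxx mulr1.
rewrite big1 ?addr0 // => a /andP[_ /negPf ac].
by rewrite mxE chart_vec_in // ac mulr0.
Qed.

Lemma mem_chart_sum x i (u : 'I_m -> K) :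
  \sum_(a in S i) u a *: chart_vec x i a \in chart x i.
Proof. by apply: memv_suml => a aS; apply/memvZ/chart_vec_mem. Qed.

Lemma dim_chart x i : \dim (chart x i) = #|S i|.
Proof.
rewrite /chart span_def big_map big_enum /=.
have /directvP/= -> : directv (\sum_(a in S i) <[chart_vec x i a]>).
  apply/directv_sum_independent => us usP us0 c cS.
  have us_sum a : a \in S i -> us a = us a 0 a *: chart_vec x i a.
    move=> aS; have /vlineP[k ->] := usP a aS.
    by rewrite mxE chart_vec_in // eqxx mulr1.
  rewrite us_sum // -(chart_sum x (fun a => us a 0 a) cS).
  by rewrite -(eq_bigr _ us_sum) us0 mxE scale0r.
rewrite -sum1_card; apply: eq_bigr => a aS.
rewrite dim_vline; case: eqP => // /rowP/(_ a)/eqP.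
by rewrite chart_vec_in // mxE eqxx oner_eq0.
Qed.

Lemma eq_chart x y i : (forall k : 'I_N, (enum_val k).1.1 = i -> x k = y k) ->
  chart x i = chart y i.
Proof.
move=> xy; congr (span _); apply: eq_map => a; congr (_ + _).
by apply: eq_bigr => k /eqP Ek; rewrite xy // Ek.
Qed.

Lemma limg_chart_sub x i j (f : 'End('rV[K]_m)) :
  (forall a, a \in S i -> f (chart_vec x i a) \in chart x j) ->
  (f @: chart x i <= chart x j)%VS.
Proof.
move=> fS; rewrite limg_span; apply/span_subvP => _ /mapP[_ /imageP[a aS ->] ->].
exact: fS.
Qed.
End Charts.

Section LinearAlgebra.
Variables (K : fieldType) (m : nat).
Implicit Types (V : {vspace 'rV[K]_m}).

Lemma lfun_coord (f : 'End('rV[K]_m)) v b :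
  (f v) 0 b = \sum_a v 0 a * (f 'e_a) 0 b.
Proof.
rewrite {1}(row_sum_delta v) linear_sum summxE; apply: eq_bigr => a _.
by rewrite linearZ mxE.
Qed.

(** Reduced echelon form with respect to the pivot columns S: choose columns where
    a basis of V has an invertible minor and normalize that minor to the identity. *)
Lemma echelon_basis V : exists (S : {set 'I_m}) (X : 'I_m -> 'rV[K]_m),
  #|S| = \dim V /\
  forall a, a \in S -> X a \in V /\ forall c, c \in S -> X a 0 c = (a == c)%:R.
Proof.
pose A : 'M[K]_(\dim V, m) := \matrix_i (vbasis V)`_i.
have AV (u : 'rV_(\dim V)) : u *m A \in V.
  rewrite mulmx_sum_row; apply: memv_suml => i _; apply: memvZ.
  by rewrite rowK vbasis_mem // mem_nth // size_tuple.
have freeA : row_free A.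
  apply: inj_row_free => u uA; apply/rowP=> i; rewrite mxE.
  have /freeP/(_ (u 0)) := basis_free (vbasisP V); apply.
  by rewrite -[RHS]uA mulmx_sum_row; apply: eq_bigr => j _; rewrite rowK.
have fullA : row_full A^T by rewrite -col_leq_rank mxrank_tr row_leq_rank.
pose s := fullrankfun fullA; have s_inj : injective s by apply: fullrankfun_inj.
have sA : colsub s A \in unitmx.
  by rewrite -unitmx_tr trmx_mxsub fullrowsub_unit.
pose Y := invmx (colsub s A) *m A.
have YV i : row i Y \in V by rewrite row_mul.
have Ys i j : Y i (s j) = (i == j)%:R.
  have /matrixP/(_ i j) := mulVmx sA; rewrite mxE mxE mxE => <-.
  by apply: eq_bigr => k _; rewrite [in RHS]mxE.
exists [set s i | i : 'I_(\dim V)], (fun a => \sum_(i | s i == a) row i Y).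
rewrite card_imset // card_ord; split=> // _ /imsetP[i _ ->].
rewrite (big_pred1 i) => [|j]; last by rewrite /= (inj_eq s_inj).
by split=> // _ /imsetP[j _ ->]; rewrite mxE Ys (inj_eq s_inj).
Qed.
End LinearAlgebra.

(** The standard charts cover the product of Grassmannians. *)
Lemma chart_exists (K : fieldType) (m n : nat) (V : 'I_n -> {vspace 'rV[K]_m}) :
  exists S : 'I_n -> {set 'I_m}, exists x : 'I_#|chart_idx S| -> K,
    (forall i, #|S i| = \dim (V i)) /\ (forall i, chart x i = V i).
Proof.
have [S] := fin_all_exists (fun i => echelon_basis (V i)).
case/fin_all_exists=> X SX.
pose x (k : 'I_#|chart_idx S|) := X (enum_val k).1.1 (enum_val k).1.2 0 (enum_val k).2.
exists S, x; split=> i; first by case: (SX i).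
have [dS XS] := SX i; apply/eqP; rewrite eqEdim dim_chart dS leqnn andbT.
apply/span_subvP => _ /imageP[a aS ->].
have [XV Xc] := XS a aS; rewrite (_ : chart_vec x i a = X i a) //.
apply/rowP=> b; have [bS|bS] := boolP (b \in S i).
  by rewrite chart_vec_in // Xc.
have abS : (i, a, b) \in chart_idx S by rewrite inE /= aS bS.
rewrite (chart_vec_out x (k := enum_rank_in abS (i, a, b))) ?enum_rankK_in //.
by rewrite /x enum_rankK_in.
Qed.

(** * Injective maps give smooth equations *)

Section ChartPolynomials.
Variables (K : fieldType) (m n : nat) (S : 'I_n -> {set 'I_m}).
Local Notation N := #|chart_idx S|.
Implicit Types (x y : 'I_N -> K) (D : {set 'I_N}) (F : 'End('rV[K]_m)).

Definition chart_poly (i : 'I_n) (a b : 'I_m) : {mpoly K[N]} :=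
  (a == b)%:R%:MP + \sum_(k < N | enum_val k == (i, a, b)) 'X_k.

Definition image_poly F (i : 'I_n) (a b : 'I_m) : {mpoly K[N]} :=
  \sum_c (F 'e_c) 0 b *: chart_poly i a c.

Lemma meval_chart_poly x i a b : (chart_poly i a b).@[x] = chart_vec x i a 0 b.
Proof.
rewrite mevalD mevalC chart_vecE (raddf_sum (meval x)); congr (_ + _).
by apply: eq_bigr => k _; rewrite /= mevalXU.
Qed.

Lemma meval_image_poly F x i a b : (image_poly F i a b).@[x] = F (chart_vec x i a) 0 b.
Proof.
rewrite (raddf_sum (meval x)) lfun_coord; apply: eq_bigr => c _.
by rewrite /= mevalZ meval_chart_poly mulrC.
Qed.

Lemma indep_chart_poly D i a b : (forall k, k \in D -> enum_val k != (i, a, b)) ->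
  indep D (chart_poly i a b).
Proof.
move=> Dk; apply: indepD; first exact: indepC.
by apply: indep_sum => k Ek; apply: indepX; apply: contraL Ek => /Dk.
Qed.

Lemma indep_image_poly D F i a b : (forall k, k \in D -> (enum_val k).1.1 != i) ->
  indep D (image_poly F i a b).
Proof.
move=> Dk; apply: indep_sum => c _; rewrite -mul_mpolyC.
apply: indepM; [exact: indepC | apply: indep_chart_poly => k /Dk].
by apply: contra => /eqP->.
Qed.

Definition coords_above (i : 'I_n) : {set 'I_N} :=
  [set k : 'I_N | (i < (enum_val k).1.1)%N].

(** The inclusion F V_j <= V_k says that, for a in S j and b outside S k, the
    b-coordinate of F (chart_vec y j a) is the combination of the coordinates
    X_(k,a',b) with coefficients its own coordinates on S k.  At x, F being
    injective, the matrix of these coefficients has independent rows, hence a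
    maximal minor delta that is nonzero, on columns T.  Keeping the terms with a'
    in T on one side, the inclusion is the family of systems P X = rho, one for
    each b, with \det P = delta; multiplying by the adjugate of P puts it into the
    form required by [smooth_avoiding_step]. *)
Lemma smooth_avoiding_injective F (j k : 'I_n) (Z0 Z1 : ('I_N -> K) -> Prop) x :
    k = j.+1 :> nat -> lker F == 0%VS ->
    smooth_avoiding (coords_above j) Z0 x ->
    (forall y z, Z0 y -> (forall l, l \notin coords_above j -> y l = z l) -> Z0 z) ->
    (forall y, Z1 y <-> Z0 y /\ (F @: chart y j <= chart y k)%VS) ->
    Z1 x ->
  smooth_avoiding (coords_above k) Z1 x.
Proof.
move=> kj kerF Z0smooth Z0inv Z1E Z1x.
have Fx : (F @: chart x j <= chart x k)%VS by case/Z1E: Z1x.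
pose M := \matrix_(r < #|S j|, c < #|S k|)
  F (chart_vec x j (enum_val r)) 0 (enum_val c).
have fullM : row_full M^T.
  rewrite -col_leq_rank mxrank_tr row_leq_rank; apply: inj_row_free => u uM.
  pose v := \sum_r u 0 r *: chart_vec x j (enum_val r).
  have vx : v \in chart x j.
    by apply: memv_suml => r _; apply/memvZ/chart_vec_mem/enum_valP.
  have Fv0 : F v = 0.
    apply: (@chart_eq0 _ _ _ _ x k); first exact/(subvP Fx)/memv_img.
    move=> a aS; have /rowP/(_ (enum_rank_in aS a)) := uM; rewrite !mxE => s0.
    rewrite -[RHS]s0 linear_sum summxE; apply: eq_bigr => r _.
    by rewrite linearZ !mxE enum_rankK_in.
  have v0 : v = 0 by move/lker0P: kerF; apply; rewrite Fv0 linear0.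
  apply/rowP=> r; rewrite mxE; have /rowP/(_ (enum_val r)) := v0; rewrite [RHS]mxE => <-.
  rewrite summxE (bigD1 r) //= big1 ?addr0 => [|r' /negPf r'r].
    by rewrite mxE chart_vec_in ?enum_valP // eqxx mulr1.
  by rewrite mxE chart_vec_in ?enum_valP // (inj_eq enum_val_inj) r'r mulr0.
(* The columns of the minor, as elements t r of S k. *)
pose t (r : 'I_#|S j|) := enum_val (fullrankfun fullM r).
have t_inj : injective t by move=> r r' /enum_val_inj/fullrankfun_inj.
have tS r : t r \in S k by apply: enum_valP.
pose T := [set t r | r : 'I_#|S j|].
pose P := \matrix_(r < #|S j|, r' < #|S j|) image_poly F j (enum_val r) (t r').
pose rho b := \col_(r < #|S j|) (image_poly F j (enum_val r) b
  - \sum_(a in S k | a \notin T) image_poly F j (enum_val r) a * chart_poly k a b).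
(* The sum has exactly one term when the coordinate l belongs to B; it recovers
   the column index r from l. *)
pose q (l : 'I_N) := \sum_(r | t r == (enum_val l).1.2)
  (\adj P *m rho (enum_val l).2) r 0.
pose B := [set l : 'I_N | ((enum_val l).1.1 == k) && ((enum_val l).1.2 \in T)].
pose X y b := \col_r chart_vec y k (t r) 0 b.
have imgE y : (F @: chart y j <= chart y k)%VS <->
    (forall b, b \notin S k -> map_mx (meval y) P *m X y b = map_mx (meval y) (rho b)).
  have split_sum b (r : 'I_#|S j|) :
      (map_mx (meval y) P *m X y b) r 0 - map_mx (meval y) (rho b) r 0 =
      \sum_(a in S k) F (chart_vec y j (enum_val r)) 0 a * chart_vec y k a 0 b
        - F (chart_vec y j (enum_val r)) 0 b.
    rewrite !mxE mevalB meval_image_poly opprB addrA; congr (_ - _).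
    rewrite [RHS](bigID (mem T)) /= (raddf_sum (meval y)); congr (_ + _); last first.
      by apply: eq_bigr => a _; rewrite /= mevalM meval_image_poly meval_chart_poly.
    rewrite (eq_bigl (mem T)) => [|a]; last first.
      by rewrite andb_idl // => /imsetP[r' _ ->].
    rewrite big_imset /=; last by move=> ? ? _ _ /t_inj.
    by apply: eq_bigr => r' _; rewrite !mxE meval_image_poly.
  split=> [/subvP Fy b bS|PX].
    apply/colP=> r; apply/eqP; rewrite -subr_eq0 split_sum subr_eq0 eq_sym.
    have := Fy _ (memv_img F (chart_vec_mem y (enum_valP r))).
    rewrite mem_chart => /eqP/rowP/(_ b)->; rewrite summxE.
    by apply/eqP/eq_bigr => a aS; rewrite mxE.
  apply: limg_chart_sub => a aS; rewrite mem_chart; apply/eqP/rowP=> b.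
  have [bS|bS] := boolP (b \in S k).
    by rewrite (chart_sum y (fun c => F (chart_vec y j a) 0 c)).
  have /colP/(_ (enum_rank_in aS a))/eqP := PX b bS.
  rewrite -subr_eq0 split_sum subr_eq0 enum_rankK_in // => /eqP<-.
  by rewrite [RHS]summxE; apply: eq_bigr => c cS; rewrite [RHS]mxE.
have qE y l r b : enum_val l = (k, t r, b) ->
    (q l).@[y] = (\adj (map_mx (meval y) P) *m map_mx (meval y) (rho b)) r 0.
  move=> El; rewrite /q El /= (big_pred1 r) => [|r']; last by rewrite /= (inj_eq t_inj).
  by rewrite -map_mx_adj -map_mxM [RHS]mxE.
have detE y : (\det P).@[y] = \det (map_mx (meval y) P) by rewrite det_map_mx.
have lB l : l \in B -> exists r b, enum_val l = (k, t r, b) /\ b \notin S k.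
  rewrite [l \in B]inE; have := enum_valP l; rewrite inE.
  case: (enum_val l) => [[i a] b] /= /andP[_ bS] /andP[/eqP ik /imsetP[r _ ar]].
  by exists r, b; rewrite -ik ar.
have yE y l r b : enum_val l = (k, t r, b) -> y l = X y b r 0.
  by move=> El; rewrite mxE (chart_vec_out y El).
have adjP y : \adj (map_mx (meval y) P) *m map_mx (meval y) P = ((\det P).@[y])%:M.
  by rewrite mul_adj_mx detE.
have jB l : l \in B :|: coords_above k -> (j < (enum_val l).1.1)%N.
  rewrite inE => /orP[/lB[r [b [-> _]]]|]; first by rewrite kj.
  by rewrite inE; apply: ltn_trans; rewrite kj.
have indepP : indep (B :|: coords_above k) (\det P).
  apply: indep_det => r r'; rewrite mxE; apply: indep_image_poly => l /jB.
  by apply: contraTneq => ->; rewrite ltnn.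
have indepq l : l \in B -> indep (B :|: coords_above k) (q l).
  move=> _; apply: indep_sum => r _; rewrite mxE; apply: indep_sum => r' _.
  have fj c : indep (B :|: coords_above k) (image_poly F j (enum_val r') c).
    by apply: indep_image_poly => l' /jB; apply: contraTneq => ->; rewrite ltnn.
  apply: indepM.
    apply: indep_adj => a c; rewrite mxE; apply: indep_image_poly => l' /jB.
    by apply: contraTneq => ->; rewrite ltnn.
  rewrite mxE; apply: indepD => //; apply/indepN/indep_sum => a /andP[_ aT].
  apply: indepM => //; apply: indep_chart_poly => l' l'B.
  apply: contraL l'B => /eqP El'; rewrite inE [l' \in B]inE [l' \in coords_above k]inE El' /=.
  by rewrite ltnn (negPf aT) andbF.
apply: (smooth_avoiding_step (B := B) (delta := \det P) (q := q) Z0smooth) => //.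
- by apply/subsetP=> l /jB; rewrite inE.
- apply/pred0P=> l /=; apply/negP=> /andP[/lB[r [b [El _]]]].
  by rewrite [l \in coords_above k]inE El /= ltnn.
- by move=> y /Z1E[].
- move=> y /Z1E[_ /imgE PX] l lBl; have [r [b [El bS]]] := lB l lBl.
  rewrite (qE _ _ _ _ El) (yE _ _ _ _ El) -(PX b bS) mulmxA adjP.
  by rewrite mul_scalar_mx [RHS]mxE.
- move=> y Z0y dy0 yq; apply/Z1E; split=> //; apply/imgE=> b bS.
  have adjX : \adj (map_mx (meval y) P) *m map_mx (meval y) (rho b) =
              (\det P).@[y] *: X y b.
    apply/colP=> r.
    have lS : (k, t r, b) \in chart_idx S by rewrite inE /= tS bS.
    have El := enum_rankK_in lS lS.
    rewrite -(qE _ _ _ _ El) -yq ?inE ?El /= ?eqxx ?imset_f //.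
    by rewrite [RHS]mxE -(yE _ _ _ _ El).
  apply: (scalerI dy0); rewrite scalemxAr -adjX mulmxA mul_mx_adj -detE.
  by rewrite mul_scalar_mx.
rewrite detE (_ : map_mx _ _ = (rowsub (fullrankfun fullM) M^T)^T).
  by rewrite -unitfE -unitmxE unitmx_tr fullrowsub_unit.
by apply/matrixP=> r r'; rewrite !mxE meval_image_poly.
Qed.
End ChartPolynomials.

Lemma smooth_avoiding_all (K : numFieldType) N D (Z : ('I_N -> K) -> Prop) x :
  (forall y, Z y) -> smooth_avoiding D Z x.
Proof.
move=> Zall; exists 0%N, (fun=> 0), 1; split=> [|||p Zp]; last 1 first.
- exists 0%N; rewrite expr0 mul1r (_ : p = 0); first exact: in_ideal0.
  by apply: mpoly_eq0_eval => y; apply: Zp.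
- by rewrite meval1 oner_eq0.
- by apply/eqP; rewrite -leqn0 rank_leq_row.
- by case.
Qed.

Lemma dim_rV (K : fieldType) m : dim 'rV[K]_m = m.
Proof. exact: mul1n. Qed.

Section Smoothness.
Variables (K : numFieldType) (m n : nat).

(** Induction on l, for the set Z l defined by the conditions f_i V_i <= V_(i+1)
    with i < l, which constrain only the subspaces V_0, ..., V_l. *)
Lemma smooth_degeneration (d : 'I_n -> nat) (f : 'I_n.-1 -> 'End('rV[K]_m)) :
    (forall i, \dim (limg (f i)) = 0%N \/ \dim (limg (f i)) = m) ->
  smooth_in_Gr d (linear_degeneration d f).
Proof.
move=> rkf S dS x [_ fx].
have [n0|n_gt0] := posnP n.
  apply: (@smooth_avoiding_at _ _ set0); apply: smooth_avoiding_all => y.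
  split=> i; first by rewrite dim_chart.
  by exfalso; have := ltn_ord i; move: (nat_of_ord i); rewrite n0.
pose Z l y := forall (i : 'I_n.-1) (j k : 'I_n), (i < l)%N ->
  j = i :> nat -> k = i.+1 :> nat -> (f i @: chart y j <= chart (S := S) y k)%VS.
have Zall y : linear_degeneration d f (chart y) <-> Z n.-1 y.
  split=> [[_ fy] i j k _ ji ki|Zy]; first exact: fy.
  by split=> [i|i j k]; [rewrite dim_chart | apply: Zy].
have Zx l : Z l x by move=> i j k _; apply: fx.
have tower l (ln : (l < n)%N) : smooth_avoiding (coords_above S (Ordinal ln)) (Z l) x.
  elim: l ln => [|l IHl] ln.
    exact: smooth_avoiding_all.
  have ln' : (l < n)%N := ltnW ln.
  have ln1 : (l < n.-1)%N by rewrite -ltnS prednK.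
  pose i := Ordinal ln1.
  have ZS y : Z l.+1 y <-> Z l y /\
      (f i @: chart y (Ordinal ln') <= chart y (Ordinal ln))%VS.
    split=> [Zy|[Zy fy] i' j k i'l ji ki].
      split=> [i' j k i'l|]; last exact: Zy.
      by apply: Zy; apply: ltnW.
    move: i'l; rewrite ltnS leq_eqVlt => /orP[/eqP i'l|i'l]; last exact: Zy.
    have -> : i' = i by apply: val_inj.
    have -> : j = Ordinal ln' by apply: val_inj; rewrite /= ji.
    by have -> : k = Ordinal ln by apply: val_inj; rewrite /= ki i'l.
  have [fi0|fim] := rkf i.
    have [c [g [h [hx rk Zg gen]]]] := IHl ln'.
    have ZZ y : Z l.+1 y <-> Z l y.
      rewrite ZS; split=> [[]//|Zy]; split=> //.
      move/eqP: fi0; rewrite dimv_eq0 => /eqP fi0.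
      by apply: subv_trans (sub0v _); rewrite -fi0 limgS ?subvf.
    exists c, g, h; split=> // [j|p Zp]; last by apply: gen => y /ZZ/Zp.
    split=> [y /ZZ|]; first exact: (Zg j).1.
    apply: indep_subset (Zg j).2; apply/subsetP=> k.
    by rewrite !inE; apply: ltn_trans.
  apply: (smooth_avoiding_injective (F := f i) _ _ (IHl ln')) => //.
    rewrite -dimv_eq0; have := limg_ker_dim (f i) fullv.
    by rewrite fim capfv dimvf dim_rV => /(@addIn m _ 0%N)->.
  move=> y z Zy yz i' j k i'l ji ki.
  have cE (o : 'I_n) : (o <= l)%N -> chart z o = chart y o.
    move=> ol; apply: eq_chart => k' k'o; rewrite yz // inE -leqNgt /=.
    by rewrite k'o.
  by rewrite !cE ?ji ?ki // 1?ltnW //; apply: Zy.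
have ln : (n.-1 < n)%N by rewrite prednK.
have [c [g [h [hx rk Zg gen]]]] := smooth_avoiding_at (tower _ ln).
exists c, g, h; split=> // [j y /Zall|p Zp]; first exact: Zg.
by apply: gen => y /Zall/Zp.
Qed.
End Smoothness.

(** * Subspaces and linear forms *)

Section Flags.
Variables (K : fieldType) (m : nat).
Implicit Types (U V W : {vspace 'rV[K]_m}) (v : 'rV[K]_m) (xi : 'cV[K]_m).

(** Column vectors serve as linear forms on row vectors. *)
Definition pairing v xi : K := (v *m xi) 0 0.

Lemma pairingD v v' xi : pairing (v + v') xi = pairing v xi + pairing v' xi.
Proof. by rewrite /pairing mulmxDl mxE. Qed.

Lemma pairingZ c v xi : pairing (c *: v) xi = c * pairing v xi.
Proof. by rewrite /pairing -scalemxAl mxE. Qed.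

Lemma pairing_sum (I : Type) (r : seq I) (P : pred I) (F : I -> 'rV[K]_m) xi :
  pairing (\sum_(i <- r | P i) F i) xi = \sum_(i <- r | P i) pairing (F i) xi.
Proof. by rewrite /pairing mulmx_suml summxE. Qed.

Lemma separating_functional U v : v \notin U ->
  exists xi, pairing v xi = 1 /\ forall y, y \in U -> pairing y xi = 0.
Proof.
move=> vU; pose g : 'End('rV[K]_m) := (\1 - projv U)%VF.
have gE y : g y = y - projv U y by rewrite !lfunE /= !lfunE.
have [b gvb] : exists b, (g v) 0 b != 0.
  apply/existsP; apply: contraR vU; rewrite negb_exists => /forallP gv0.
  have gv : g v = 0 by apply/rowP=> b; rewrite mxE; apply/eqP/negbNE/gv0.
  by move/eqP: gv; rewrite gE subr_eq0 => /eqP->; apply: memv_proj.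
exists (\col_c ((g 'e_c) 0 b / (g v) 0 b)).
have pE y : pairing y (\col_c ((g 'e_c) 0 b / (g v) 0 b)) = (g y) 0 b / (g v) 0 b.
  rewrite /pairing mxE (lfun_coord g y) mulr_suml; apply: eq_bigr => c _.
  by rewrite mxE mulrA.
split=> [|y yU]; first by rewrite pE divff.
by rewrite pE gE projv_id // subrr mxE mul0r.
Qed.

Lemma dim_add_line U v : v \notin U -> \dim (U + <[v]>) = (\dim U).+1.
Proof.
move=> vU; apply/eqP; rewrite eqn_leq; apply/andP; split.
  apply: leq_trans (dimv_add_leqif _ _) _.
  by rewrite -(addn1 (\dim U)) leq_add2l dim_vline leq_b1.
rewrite ltn_neqAle dimvS ?addvSl // andbT.
rewrite (dimv_leqif_sup (addvSl U <[v]>)) subv_add subvv /=.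
by apply: contra vU; rewrite memvE.
Qed.

Lemma dim_between U W e : (U <= W)%VS -> (\dim U <= e)%N -> (e <= \dim W)%N ->
  exists2 V, (U <= V <= W)%VS & \dim V = e.
Proof.
move=> UW Ue eW; elim: e Ue eW => [|e IHe].
  by rewrite leqn0 => /eqP U0 _; exists U; rewrite ?subvv.
rewrite leq_eqVlt => /orP[/eqP Ue _|Ue eW]; first by exists U; rewrite ?subvv.
have [V /andP[UV VW] dV] := IHe Ue (ltnW eW).
have /subvPn[v vW vV] : ~~ (W <= V)%VS by apply/negP=> /dimvS; rewrite dV leqNgt eW.
exists (V + <[v]>)%VS; last by rewrite dim_add_line // dV.
by rewrite (subv_trans UV) ?addvSl // subv_add VW -memvE.
Qed.

Lemma hyperplane_avoiding U v : v \notin U ->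
  exists P, [/\ (U <= P)%VS, \dim P = m.-1 & v \notin P].
Proof.
move=> vU; have [xi [xv xU]] := separating_functional vU.
pose phi : 'Hom('rV[K]_m, 'rV[K]_1) := linfun (mulmxr xi).
have phiE y : phi y = y *m xi by rewrite lfunE.
have phi0 y : (phi y == 0) = (pairing y xi == 0).
  rewrite phiE /pairing; apply/eqP/eqP=> [->|y0]; first by rewrite mxE.
  by apply/rowP=> c; rewrite [c]ord1 y0 mxE.
exists (lker phi); split.
- by apply/subvP=> y yU; rewrite memv_ker phi0 xU.
- have := limg_ker_dim phi fullv; rewrite capfv dimvf dim_rV.
  suff -> : \dim (limg phi) = 1%N by rewrite addn1 => /(congr1 predn).
  apply/eqP; rewrite eqn_leq; apply/andP; split.
    by apply: leq_trans (dimvS (subvf _)) _; rewrite dimvf dim_rV.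
  rewrite lt0n dimv_eq0; apply/eqP => phi00.
  have := memv_img phi (memvf v); rewrite phi00 memv0 phi0 xv.
  by rewrite oner_eq0.
- by rewrite memv_ker phi0 xv oner_eq0.
Qed.

(** The preimage has dimension dim ker f + dim (W :&: im f). *)
Lemma leq_dim_preim (f : 'End('rV[K]_m)) W : (\dim W <= \dim (f @^-1: W))%N.
Proof.
have kerW : (f @^-1: W :&: lker f = lker f)%VS.
  apply/capv_idPr/subvP=> y; rewrite memv_ker => /eqP fy0.
  by rewrite -memv_preim fy0 mem0v.
have imW : (W :&: limg f <= f @: (f @^-1: W))%VS.
  apply/subvP=> z /memv_capP[zW /memv_imgP[y _ Ey]].
  by rewrite Ey memv_img // -memv_preim -Ey.
have := limg_ker_dim f (f @^-1: W); rewrite kerW.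
have := limg_ker_dim f fullv; rewrite capfv dimvf dim_rV.
have := dimv_sum_cap W (limg f); have := dimvS imW.
have := dimvS (subvf (W + limg f)); rewrite dimvf dim_rV.
have arith (a b c e r g h : nat) : (a <= m -> b <= c -> a + b = e + r ->
  g + r = m -> g + c = h -> e <= h)%N by lia.
exact: arith.
Qed.

Lemma leq_dim_cap_hyperplane V R : \dim R = m.-1 ->
  ((\dim V).-1 <= \dim (V :&: R))%N.
Proof.
move=> dR; have := dimv_sum_cap V R; rewrite dR.
have := dimvS (subvf (V + R)); have := dimvS (subvf V); rewrite dimvf dim_rV.
have arith (a b c : nat) : (c <= m -> a <= m -> a + b = c + m.-1 -> c.-1 <= b)%N by lia.
exact: arith.
Qed.

Lemma leq_dimv_rV V : (\dim V <= m)%N.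
Proof. by have := dimvS (subvf V); rewrite dimvf dim_rV. Qed.

(** Given the maps F t, a subspace can be prolonged to a compatible sequence of
    prescribed nondecreasing dimensions, since images do not raise the dimension. *)
Lemma ascending_chain N : forall (F : nat -> 'End('rV[K]_m)) (D : nat -> nat) U0,
    (\dim U0 <= D 0)%N -> (forall t, D t <= D t.+1)%N -> (forall t, D t.+1 <= m)%N ->
  exists U : nat -> {vspace 'rV[K]_m}, U 0 = U0 /\ forall t, (t < N)%N ->
    \dim (U t.+1) = D t.+1 /\ (F t @: U t <= U t.+1)%VS.
Proof.
elim: N => [|N IHN] F D U0 dU0 Dincr Dm; first by exists (fun=> U0).
have [||V /andP[FV _] dV] := @dim_between (F 0%N @: U0) fullv (D 1%N) (subvf _).
- apply: leq_trans (Dincr 0%N); apply: leq_trans dU0.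
  by rewrite -(limg_ker_dim (F 0%N) U0) leq_addl.
- by rewrite dimvf dim_rV.
have [|t|t|U [U0E US]] := IHN (F \o S) (D \o S) V; [by rewrite dV | exact: Dincr | exact: Dm |].
exists (fun t => if t is t'.+1 then U t' else U0); split=> // -[_|t tN] /=.
  by rewrite U0E.
exact: US.
Qed.

(** Dual to [ascending_chain]: each term is chosen inside the preimage of the
    previous one, and preimages do not lower the dimension. *)
Lemma descending_chain N : forall (F : nat -> 'End('rV[K]_m)) (D : nat -> nat) U0,
    (D 0 <= \dim U0)%N -> (forall t, D t.+1 <= D t)%N ->
  exists U : nat -> {vspace 'rV[K]_m}, U 0 = U0 /\ forall t, (t < N)%N ->
    \dim (U t.+1) = D t.+1 /\ (F t @: U t.+1 <= U t)%VS.
Proof.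
elim: N => [|N IHN] F D U0 dU0 Ddecr; first by exists (fun=> U0).
have [||V /andP[_ VF] dV] := @dim_between 0%VS (F 0%N @^-1: U0) (D 1%N) (sub0v _).
- by rewrite dimv0.
- by apply: leq_trans (leq_dim_preim _ _); apply: leq_trans dU0.
have [|t|U [U0E US]] := IHN (F \o S) (D \o S) V; [by rewrite dV | exact: Ddecr |].
exists (fun t => if t is t'.+1 then U t' else U0); split=> // -[_|t tN] /=.
  split; first by rewrite U0E.
  rewrite U0E; apply/subvP=> _ /memv_imgP[y yV ->].
  by rewrite memv_preim (subvP VF).
exact: US.
Qed.
End Flags.

(** * A flag with an obstructed deformation *)

Section ObstructedFlag.
Variables (K : fieldType) (m n : nat) (d : 'I_n -> nat).
Variable (f : 'I_n.-1 -> 'End('rV[K]_m)).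
Hypothesis d_pos : forall i : 'I_n, (0 < d i)%N.
Hypothesis d_incr : forall i j : 'I_n, (i < j)%N -> (d i < d j)%N.
Hypothesis d_lt : forall i : 'I_n, (d i < m)%N.

(** V_j and V_k are chosen between a lower and an upper bound.  V_j contains v in
    the kernel and stays in a hyperplane Q that contains the kernel but not w, so
    that f w is not in f V_j.  V_k contains f V_j and f w, and stays in a
    hyperplane P that contains the image but not u.  The lower terms are
    built by preimages from a hyperplane H of V_j that misses v, the upper terms by
    images from V_k + <[u]>; both are possible because the dimensions increase
    strictly. *)
Lemma obstructed_flag (i0 : 'I_n.-1) (j k : 'I_n) :
    j = i0 :> nat -> k = i0.+1 :> nat ->
    (0 < \dim (limg (f i0)))%N -> (\dim (limg (f i0)) < m)%N ->
  exists (V : 'I_n -> {vspace 'rV[K]_m}) (H : {vspace 'rV[K]_m}) v w u,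
  [/\ linear_degeneration d f V,
      [/\ v \in V j, v \notin H, f i0 v = 0 & (forall (i : 'I_n.-1) (j' : 'I_n),
         j' = i :> nat -> j = i.+1 :> nat -> (f i @: V j' <= H)%VS)],
      f i0 w \in V k, f i0 w \notin (f i0 @: V j)%VS &
      u \notin (V k + limg (f i0))%VS /\
      (forall (i : 'I_n.-1) (k' : 'I_n), k = i :> nat -> k' = i.+1 :> nat ->
         f i u \in V k')].
Proof.
set f0 := f i0 => ji ki rk_gt0 rk_lt.
have [v vker v0] : exists2 v, v \in lker f0 & v != 0.
  exists (vpick (lker f0)); first exact: memv_pick.
  rewrite vpick0 -dimv_eq0; apply: contraTneq rk_lt => ker0.
  by have := limg_ker_dim f0 fullv; rewrite capfv ker0 dimvf dim_rV add0n => ->; rewrite ltnn.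
have [w fw0] : exists w, f0 w != 0.
  have : vpick (limg f0) \in limg f0 by apply: memv_pick.
  move=> /memv_imgP[w _ Ew]; exists w.
  by rewrite -Ew vpick0 -dimv_eq0 -lt0n.
have [u _ uim] : exists2 u, u \in fullv & u \notin limg f0.
  apply/subvPn; apply: contraTN rk_lt => /dimvS.
  by rewrite dimvf dim_rV -leqNgt.
have [Q [kerQ dQ wQ]] : exists P, [/\ (lker f0 <= P)%VS, \dim P = m.-1 & w \notin P].
  by apply: hyperplane_avoiding; rewrite memv_ker.
have [P [imP dP uP]] := hyperplane_avoiding uim.
have dj_gt0 := d_pos j; have dj_lt := d_lt j; have dk_lt := d_lt k.
have djk : (d j < d k)%N by apply: d_incr; rewrite ji ki.
have [|||V1 /andP[vV1 V1Q] dV1] := @dim_between _ _ <[v]>%VS Q (d j).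
- by rewrite -memvE (subvP kerQ).
- by rewrite dim_vline v0.
- by rewrite dQ -ltnS prednK // (leq_trans _ dj_lt).
rewrite -memvE in vV1.
have [|||V2 /andP[fV2 V2P] dV2] := @dim_between _ _ (f0 @: V1 + <[f0 w]>)%VS P (d k).
- rewrite subv_add -memvE (subvP imP) ?memv_img ?memvf // andbT.
  by apply: subv_trans imP; rewrite limgS ?subvf.
- apply: leq_trans (dimv_add_leqif _ _) _; rewrite dim_vline fw0 addn1.
  by apply: leq_ltn_trans djk; rewrite -dV1 -(limg_ker_dim f0 V1) leq_addl.
- by rewrite dP -ltnS prednK // (leq_trans _ dk_lt).
move: fV2; rewrite subv_add -memvE => /andP[fV1 fwV2].
have [R [_ dR vR]] : exists P, [/\ (0 <= P)%VS, \dim P = m.-1 & v \notin P].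
  by apply: hyperplane_avoiding; rewrite memv0.
pose H := (V1 :&: R)%VS.
have dH : ((d j).-1 <= \dim H)%N.
  by rewrite -dV1; apply: leq_dim_cap_hyperplane.
(* f and d are extended to all natural indices, d by m, so that the chains below
   need no bound on their length. *)
pose F l : 'End('rV[K]_m) := odflt 0 (omap f (insub l)).
have FE (i : 'I_n.-1) : F i = f i by rewrite /F valK.
pose D l : nat := odflt m (omap d (insub l)).
have DE (i : 'I_n) : D i = d i by rewrite /D valK.
have Dm l : (D l <= m)%N by rewrite /D; case: insubP => //= i _ _; apply: ltnW.
have Dincr l l' : (l < l' -> l < n -> D l < D l')%N.
  move=> ll' ln; rewrite (DE (Ordinal ln)) /D; case: insubP => [i _ Ei|_] //=.
  by apply: d_incr; rewrite /= Ei.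
have Dle l l' : (l < l' -> D l <= D l')%N.
  have [ln|nl] := ltnP l n; first by move=> ll'; apply/ltnW/Dincr.
  by move=> ll'; rewrite /D !insubF //= ltnNge ?nl // (leq_trans nl) // ltnW.
have [||L [L0 LS]] := @descending_chain _ _ j (fun t => F (j - t.+1)%N)
  (fun t => if t is 0 then (d j).-1 else if (t <= j)%N then D (j - t)%N else 0%N) H.
- exact: dH.
- case=> [|t]; case: ifP => // tj; have jn := ltn_ord j.
    by rewrite -ltnS prednK // -DE; apply: Dincr; clear -tj jn; lia.
  by rewrite (ltnW tj); apply: Dle; clear -tj; lia.
have [|||U [U0 US]] := @ascending_chain _ _ n (fun t => F (k + t)%N)
  (fun t => if t is 0 then (d k).+1 else D (k + t)%N) (V2 + <[u]>)%VS.
- by rewrite dim_add_line ?dV2 //; apply: contra uP; apply/subvP.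
- case=> [|t]; last by apply: Dle; rewrite ltn_add2l.
  by rewrite -DE; apply: Dincr; rewrite // -[ltnLHS]addn0 ltn_add2l.
- by move=> t.
pose V (i : 'I_n) := if (i < j)%N then L (j - i)%N else
  if i == j then V1 else if i == k then V2 else U (i - k)%N.
have Vj : V j = V1 by rewrite /V ltnn eqxx.
have Vk : V k = V2.
  by rewrite /V ki -ji ltnNge leqnSn /= -val_eqE /= ki ji gtn_eqF ?eqxx.
have Vlow (i : 'I_n) : (i < j)%N -> V i = L (j - i)%N by rewrite /V => ->.
have Vup (i : 'I_n) : (k < i)%N -> V i = U (i - k)%N.
  rewrite ki -ji => ik; rewrite /V ltnNge (ltnW (ltnW ik)) /= -!val_eqE /=.
  by rewrite ki -ji !gtn_eqF // ltnW.
(* The four ranges of indices in the definition of V. *)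
have cases (i : 'I_n) : [\/ (i < j)%N, i = j, i = k | (k < i)%N].
  have [?|ij|/val_inj?] := ltngtP i j; [by constructor 1 | | by constructor 2].
  have [ik|?|/val_inj?] := ltngtP i k; [|by constructor 4|by constructor 3].
  by move: ik; rewrite ki -ji ltnS leqNgt ij.
have lowH (i : 'I_n.-1) (j' : 'I_n) : j' = i :> nat -> j = i.+1 :> nat ->
    (f i @: V j' <= H)%VS.
  move=> j'i ji'; have j'j : (j' < j)%N by rewrite j'i ji'.
  have := LS 0%N; rewrite L0 ji' subSS subn0 => /(_ isT)[_].
  by rewrite FE Vlow // j'i ji' subSnn.
have upU (i : 'I_n.-1) (k' : 'I_n) : k = i :> nat -> k' = i.+1 :> nat ->
    (f i @: (V2 + <[u]>) <= V k')%VS.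
  move=> k'i ki'; have kk' : (k < k')%N by rewrite k'i ki'.
  have n_gt0 : (0 < n)%N by apply: leq_ltn_trans (ltn_ord k).
  have := US 0%N n_gt0; rewrite U0 addn0 k'i => -[_].
  by rewrite FE Vup // k'i ki' subSnn.
exists V, H, v, w, u; split.
- split=> [i|i j' k' j'i k'i].
    case: (cases i) => [ij|->|->|ik]; rewrite ?Vj ?Vk //.
      have [t Et] : exists t, (j - i)%N = t.+1.
        by exists (j - i).-1; rewrite prednK // subn_gt0.
      have tj : (t < j)%N by rewrite -Et leq_subr.
      by rewrite Vlow // Et (LS t tj).1 -Et leq_subr (subKn (ltnW ij)) DE.
    have [t Et] : exists t, (i - k)%N = t.+1.
      by exists (i - k).-1; rewrite prednK // subn_gt0.
    have tn : (t < n)%N by rewrite -Et (leq_trans (leq_subr _ _)) // ltnW.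
    by rewrite Vup // Et (US t tn).1 -Et subnKC ?DE // ltnW.
  case: (cases k') => [k'j|k'j|k'k|kk'].
  - have j'j : (j' < j)%N by rewrite j'i -ltnS -k'i ltnW.
    have [|_] := LS (j - k')%N; first by clear -k'j k'i; lia.
    have -> : (j - (j - k').+1 = i)%N by clear -k'j k'i; lia.
    by rewrite FE !Vlow // (_ : (j - k').+1 = j - j')%N //; clear -j'i k'i k'j; lia.
  - rewrite k'j Vj; apply: subv_trans (capvSl V1 R).
    by apply: lowH; rewrite -?k'j.
  - have -> : i = i0 by apply: val_inj => /=; move: k'i; rewrite k'k ki => -[].
    have -> : j' = j.
      by apply: val_inj => /=; move: k'i; rewrite k'k ki j'i ji => -[].
    by rewrite k'k Vj Vk.
  - have [kj'|j'k|j'k] := ltngtP k j'; last 2 first.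
    + by move: kk'; rewrite k'i -j'i ltnS leqNgt j'k.
    + rewrite -(val_inj j'k) Vk; apply: subv_trans (upU i k' _ k'i).
        by rewrite limgS ?addvSl.
      by rewrite j'k j'i.
    have [|_] := US (j' - k)%N; first by move: (ltn_ord j'); clear -kj'; lia.
    rewrite subnKC ?(ltnW kj') // j'i FE -j'i !Vup //.
    by rewrite (_ : (j' - k).+1 = k' - k)%N //; clear -j'i k'i kj'; lia.
- rewrite Vj; split=> //; [by rewrite memv_cap (negPf vR) andbF | by apply/eqP; rewrite -memv_ker].
- by rewrite Vk.
- rewrite Vj; apply: contra wQ => /memv_imgP[z zV1 fwz].
  rewrite -(subrK z w); apply: memvD; last exact: (subvP V1Q).
  by apply: (subvP kerQ); rewrite memv_ker linearB /= fwz subrr.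
rewrite Vk; split=> [|i k' k'i ki'].
  by apply: contra uP; apply/subvP; rewrite subv_add V2P.
apply: (subvP (upU i k' k'i ki')); apply: memv_img.
by apply: (subvP (addvSr V2 _)); apply: memv_line.
Qed.
End ObstructedFlag.

(** * Singular points *)

Section MovingOneSubspace.
Variables (K : fieldType) (m n : nat) (S : 'I_n -> {set 'I_m}).
Local Notation N := #|chart_idx S|.
Variables (x : 'I_N -> K) (j : 'I_n) (xi : 'cV[K]_m) (w : 'rV[K]_m).
Hypothesis w_out : forall a, a \in S j -> w 0 a = 0.

(** The direction in the chart, at x, of the deformation of V_j that moves each of
    its vectors y to y + s xi(y) w, the other subspaces being kept. *)
Definition rank1_dir (k : 'I_N) : K :=
  if (enum_val k).1.1 == j
  then pairing (chart_vec x j (enum_val k).1.2) xi * w 0 (enum_val k).2 else 0.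

Definition moved s : 'I_N -> K := fun k => x k + s * rank1_dir k.

Lemma moved_chart_vec s a : a \in S j ->
  chart_vec (moved s) j a = chart_vec x j a + (s * pairing (chart_vec x j a) xi) *: w.
Proof.
move=> aS; apply/rowP=> b; rewrite [RHS]mxE [X in _ + X]mxE.
have [bS|bS] := boolP (b \in S j); first by rewrite !chart_vec_in // w_out // mulr0 addr0.
have lS : (j, a, b) \in chart_idx S by rewrite inE /= aS bS.
have El := enum_rankK_in lS lS.
by rewrite !(chart_vec_out _ El) /moved /rank1_dir El /= eqxx mulrA.
Qed.

Lemma moved_chart_vec_neq s i a : i != j -> chart_vec (moved s) i a = chart_vec x i a.
Proof.
move=> ij; congr (_ + _); apply: eq_bigr => k /eqP Ek.
by rewrite /moved /rank1_dir Ek /= (negPf ij) mulr0 addr0.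
Qed.

Lemma moved_chart_neq s i : i != j -> chart (moved s) i = chart x i.
Proof. by move=> ij; congr (span _); apply: eq_map => a; apply: moved_chart_vec_neq. Qed.

Lemma moved_sum s v : v \in chart x j ->
  \sum_(a in S j) v 0 a *: chart_vec (moved s) j a = v + (s * pairing v xi) *: w.
Proof.
rewrite mem_chart => /eqP Ev.
have -> : pairing v xi = \sum_(a in S j) v 0 a * pairing (chart_vec x j a) xi.
  by rewrite {1}Ev pairing_sum; apply: eq_bigr => a _; rewrite pairingZ.
rewrite {2}Ev mulr_sumr scaler_suml -big_split; apply: eq_bigr => a aS.
by rewrite moved_chart_vec // scalerDr scalerA mulrCA.
Qed.

(** The deformed V_j still receives f_(j-1) V_(j-1) because xi is zero there, so
    those vectors do not move, and is still sent into V_(j+1) because w is. *)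
Lemma moved_degeneration (d : 'I_n -> nat) (f : 'I_n.-1 -> 'End('rV[K]_m)) s :
    linear_degeneration d f (chart x) ->
    (forall (i : 'I_n.-1) (j' : 'I_n), j' = i :> nat -> j = i.+1 :> nat ->
       forall y, y \in chart x j' -> pairing (f i y) xi = 0) ->
    (forall (i : 'I_n.-1) (k : 'I_n), j = i :> nat -> k = i.+1 :> nat ->
       f i w \in chart x k) ->
  linear_degeneration d f (chart (moved s)).
Proof.
move=> [dx fx] xi0 fw; split=> [i|i j' k' j'i k'i].
  by rewrite -dx !dim_chart.
have fxjk := fx i j' k' j'i k'i.
have [j'j|j'j] := eqVneq j' j.
  have k'j : k' != j by rewrite -j'j -val_eqE /= j'i k'i gtn_eqF.
  rewrite j'j in j'i fxjk *; apply: limg_chart_sub => a aS.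
  rewrite moved_chart_vec // linearD linearZ /= moved_chart_neq // memvD //.
    by apply/(subvP fxjk)/memv_img/chart_vec_mem.
  by apply/memvZ/(fw i).
rewrite (moved_chart_neq s j'j); have [k'j|k'j] := eqVneq k' j; last first.
  by rewrite moved_chart_neq.
rewrite k'j in k'i fxjk *; apply/subvP=> _ /memv_imgP[y yx ->].
have fyx := subvP fxjk _ (memv_img (f i) yx).
have := moved_sum s fyx; rewrite (xi0 i j') // mulr0 scale0r addr0 => <-.
exact: mem_chart_sum.
Qed.
End MovingOneSubspace.

Section Singularity.
Variables (K : numFieldType) (m n : nat) (d : 'I_n -> nat).
Variable (f : 'I_n.-1 -> 'End('rV[K]_m)).
Hypothesis d_pos : forall i : 'I_n, (0 < d i)%N.
Hypothesis d_incr : forall i j : 'I_n, (i < j)%N -> (d i < d j)%N.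
Hypothesis d_lt : forall i : 'I_n, (d i < m)%N.

(** At the flag of [obstructed_flag], the polynomial p and the directions da
    (V_j tilted along v towards w) and db (V_(j+1) tilted along f w towards u)
    contradict [smooth_second_order]. *)
Lemma not_smooth_degeneration (i0 : 'I_n.-1) :
    (0 < \dim (limg (f i0)))%N -> (\dim (limg (f i0)) < m)%N ->
  ~ smooth_in_Gr d (linear_degeneration d f).
Proof.
move=> rk_gt0 rk_lt smooth.
have jn : (i0 < n)%N by move: (ltn_ord i0); clear; lia.
have kn : (i0.+1 < n)%N by move: (ltn_ord i0); clear; lia.
pose j : 'I_n := Ordinal jn; pose k : 'I_n := Ordinal kn.
have [V [H [v [w [u [VX [vV vH fv0 lowH] fwV fwN [uN upu]]]]]]] :=
  obstructed_flag d_pos d_incr d_lt (i0 := i0) (j := j) (k := k)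
    erefl erefl rk_gt0 rk_lt.
have [S [x [cS cE]]] := chart_exists V.
have [xi [xiv xiH]] := separating_functional vH.
have [eta [etaw eta0]] := separating_functional fwN.
have [ppi [piu pi0]] := separating_functional uN.
have [dV fV] := VX.
have kj : k != j by rewrite -val_eqE /= gtn_eqF.
have Xx : linear_degeneration d f (chart x).
  split=> [i|i j' k' j'i k'i]; rewrite !cE; [exact: dV | exact: fV].
have piV y : y \in V k -> pairing y ppi = 0 by move=> yV; apply/pi0/(subvP (addvSl _ _)).
have pif y : pairing (f i0 y) ppi = 0.
  by apply/pi0/(subvP (addvSr _ _))/memv_img/memvf.
pose w0 := \sum_(a in S j) w 0 a *: chart_vec x j a.
pose u0 := \sum_(a in S k) u 0 a *: chart_vec x k a.
have w0V : w0 \in V j by rewrite -cE mem_chart_sum.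
have u0V : u0 \in V k by rewrite -cE mem_chart_sum.
(* Modulo V_j and V_k, the vectors w and u may be replaced by vectors with zero
   coordinates on S j and S k, as directions in the chart require. *)
have w_out a : a \in S j -> (w - w0) 0 a = 0 by move=> aS; rewrite !mxE chart_sum // subrr.
have u_out a : a \in S k -> (u - u0) 0 a = 0 by move=> aS; rewrite !mxE chart_sum // subrr.
pose da := rank1_dir x j xi (w - w0); pose db := rank1_dir x k eta (u - u0).
pose Z y := linear_degeneration d f (chart (S := S) y).
have fj : (f i0 @: V j <= V k)%VS by apply: fV.
have fw1 : f i0 (w - w0) \in V k.
  by rewrite linearB memvB //=; apply/(subvP fj)/memv_img.
have Za s : Z (moved x j xi (w - w0) s).
  apply: (moved_degeneration w_out s Xx) => [i j' j'i ji y yV|i k' ji k'i].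
    by apply: xiH; apply: (subvP (lowH i j' j'i ji)); rewrite memv_img // -cE.
  have -> : i = i0 by apply: val_inj.
  by have -> : k' = k by [apply: val_inj; rewrite /= k'i -ji]; rewrite cE.
have Zb s : Z (moved x k eta (u - u0) s).
  apply: (moved_degeneration u_out s Xx) => [i j' j'i ki y yV|i k' ki k'i].
    have Ei : i = i0 by apply: val_inj; case: ki.
    have Ej : j' = j by apply: val_inj; rewrite /= j'i Ei.
    by apply: eta0; rewrite Ei memv_img // -cE -Ej.
  rewrite cE linearB memvB //=; first exact: upu.
  by apply: (subvP (fV i k k' ki k'i)); apply: memv_img.
(* L c is the c-coordinate of f v(y), where v(y) in V_j(y) specializes to v at x,
   and M c is the value of the form ppi on the basis vector c of V_k(y).  Writing
   f v(y) in that basis shows that p = ppi (f v(y)) = 0 on the degeneration. *)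
pose L c := \sum_(a in S j) v 0 a *: image_poly S (f i0) j a c.
pose M c := \sum_b ppi b 0 *: chart_poly K S k c b.
pose p := \sum_(c in S k) L c * M c.
have LE y c : (L c).@[y] = f i0 (\sum_(a in S j) v 0 a *: chart_vec y j a) 0 c.
  rewrite (raddf_sum (meval y)) linear_sum summxE; apply: eq_bigr => a _.
  by rewrite /= mevalZ meval_image_poly linearZ mxE.
have ME y c : (M c).@[y] = pairing (chart_vec y k c) ppi.
  rewrite (raddf_sum (meval y)) /pairing mxE; apply: eq_bigr => b _.
  by rewrite /= mevalZ meval_chart_poly mulrC.
have vE : \sum_(a in S j) v 0 a *: chart_vec x j a = v.
  by apply/esym/eqP; rewrite -mem_chart cE.
have L0 c : (L c).@[x] = 0 by rewrite LE vE fv0 mxE.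
have M0 c : c \in S k -> (M c).@[x] = 0.
  by move=> cSk; rewrite ME piV // -cE chart_vec_mem.
have Zp : vanishes_on Z p.
  move=> y [_ fy]; rewrite (raddf_sum (meval y)) /=.
  set vy := \sum_(a in S j) v 0 a *: chart_vec y j a in LE.
  have : f i0 vy \in chart y k.
    by apply: (subvP (fy i0 j k erefl erefl)); apply/memv_img/mem_chart_sum.
  rewrite mem_chart => /eqP/(congr1 (fun y => pairing y ppi)); rewrite pif pairing_sum => E.
  rewrite [RHS]E; apply: eq_bigr => c _.
  by rewrite mevalM LE ME pairingZ.
have dp0 l : (mderiv l p).@[x] = 0.
  rewrite (raddf_sum (mderiv l)) (raddf_sum (meval x)) big1 // => c cSk /=.
  by rewrite mderivM mevalD !mevalM L0 M0 // mul0r mulr0 addr0.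
have ta q : vanishes_on Z q -> (dderiv da q).@[x] = 0 by apply: dderiv_line Za.
have tb q : vanishes_on Z q -> (dderiv db q).@[x] = 0 by apply: dderiv_line Zb.
have := smooth_second_order (smooth S (fun i => etrans (cS i) (dV i)) x Xx) Xx ta tb Zp dp0.
apply/eqP; rewrite (dderiv_sum db) [dderiv da _]dderiv_sum (raddf_sum (meval x)) /=.
have daL c : (dderiv da (L c)).@[x] = f i0 (w - w0) 0 c.
  apply: (dderiv_affine (p0 := 0)) => s; rewrite LE.
  rewrite (moved_sum xi w_out); last by rewrite cE.
  by rewrite (linearD (f i0)) /= fv0 add0r linearZ mxE xiv mulr1 add0r.
have daM c : c \in S k -> (dderiv da (M c)).@[x] = 0.
  move=> cSk; apply: (dderiv_affine (p0 := 0)) => s; rewrite ME.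
  by rewrite (moved_chart_vec_neq _ _ _ _ _ kj) -ME M0 // mulr0 addr0.
have dbM c : c \in S k -> (dderiv db (M c)).@[x] = pairing (chart_vec x k c) eta.
  move=> cSk; apply: (dderiv_affine (p0 := 0)) => s; rewrite ME.
  rewrite (moved_chart_vec x eta u_out) // pairingD -ME M0 // pairingZ.
  have -> : pairing (u - u0) ppi = 1.
    by rewrite -scaleN1r pairingD pairingZ piu (piV u0) // mulr0 addr0.
  by rewrite mulr1.
rewrite (eq_bigr (fun c => pairing (f i0 (w - w0) 0 c *: chart_vec x k c) eta)) => [|c cSk].
  rewrite -pairing_sum; move: fw1; rewrite -cE mem_chart => /eqP<-.
  rewrite linearB /= -scaleN1r pairingD pairingZ etaw eta0 ?memv_img // mulr0 addr0.
  exact: oner_neq0.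
by rewrite dderiv2_mul ?L0 ?M0 // daL daM // dbM // mulr0 add0r pairingZ.
Qed.
End Singularity.

Theorem theorem3p7 (R : realType) (m n : nat) (hn : (0 < n)%N) (hnm : (n < m)%N)
    (d : 'I_n -> nat)
    (hd_pos : forall i : 'I_n, (0 < d i)%N)
    (hd_incr : forall i j : 'I_n, (i < j)%N -> (d i < d j)%N)
    (hd_lt : forall i : 'I_n, (d i < m)%N)
    (f : 'I_n.-1 -> 'End('rV[R[i]]_m)) :
  smooth_in_Gr d (linear_degeneration d f) <->
  (forall i : 'I_n.-1, \dim (limg (f i)) = 0%N \/ \dim (limg (f i)) = m).
Proof.
split=> [smooth i|]; last exact: smooth_degeneration.
have [?|rk_gt0] := posnP (\dim (limg (f i))); first by left.
right; apply/eqP; rewrite eqn_leq leq_dimv_rV /=.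
rewrite leqNgt; apply/negP=> rk_lt.
exact: (not_smooth_degeneration hd_pos hd_incr hd_lt rk_gt0 rk_lt).
Qed.
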